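(* Let $(A,[\cdot,\dots,\cdot],\alpha)$ be an $n$-ary Hom-algebra with $\dim A=n+1$, $[\cdot,\dots,\cdot]$ skew-symmetric and $\alpha$ nilpotent. Let $(e_i)_{1\le i\le n+1}$ be a basis of $A$ in which $\alpha$ is in its Jordan form, and let the structure constants of the bracket in this basis be defined by $$[e_{i_1},\dots,e_{i_n}]=\sum_{k=1}^{\dim A}c_{i_1,\dots,i_n}^k e_k .$$ If $\dim\ker\alpha\ge2$, then $(A,[\cdot,\dots,\cdot],\alpha)$ is multiplicative if and only if $c_{i_1,\dots,i_n}^k=0$ for all $1\le i_1,\dots,i_n\le\dim A$ and all $k$ such that $e_k\notin\ker\alpha$.
   Context: All linear spaces are over a field $\mathbb{K}$ of characteristic $0$, and $n\ge2$. Here an $n$-ary Hom-algebra $(A,[\cdot,\dots,\cdot],\alpha)$ is a linear space $A$ with an $n$-linear map $[\cdot,\dots,\cdot]:A^n\to A$ and a linear map $\alpha:A\to A$. It is called multiplicative if $\alpha([x_1,\dots,x_n])=[\alpha(x_1),\dots,\alpha(x_n)]$ for all $x_1,\dots,x_n\in A$. Jordan form is with the $1$'s on the superdiagonal, i.e. each $e_i$ is sent by $\alpha$ to $0$ or to $e_{i-1}$. *)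

(* Defs.v *)
From mathcomp Require Import all_boot all_order all_fingroup all_algebra.
Set Implicit Arguments.
Unset Strict Implicit.
Unset Printing Implicit Defensive.
Import GRing.Theory.
Local Open Scope ring_scope.

Definition subst_arg (A : Type) (n : nat) (x : {ffun 'I_n -> A}) (i : 'I_n)
    (u : A) : {ffun 'I_n -> A} :=
  [ffun j => if j == i then u else x j].

Definition multilinear (K : fieldType) (n : nat) (A B : lmodType K)
    (f : {ffun 'I_n -> A} -> B) : Prop :=
  forall (x : {ffun 'I_n -> A}) (i : 'I_n), linear (fun u => f (subst_arg x i u)).

(* [(-1) ^+ s] is the signature of [s], through the parity coercion. *)
Definition skew_symmetric (K : fieldType) (n : nat) (A B : lmodType K)
    (f : {ffun 'I_n -> A} -> B) : Prop :=
  forall (s : 'S_n) (x : {ffun 'I_n -> A}),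
    f [ffun j => x (s j)] = (-1) ^+ s *: f x.

Record homAlgebra (K : fieldType) (n : nat) (A : vectType K) := HomAlgebra {
  bracket : {ffun 'I_n -> A} -> A;
  twist : 'End(A);
  bracket_multilinear : multilinear bracket
}.

Definition homAlgebra_multiplicative (K : fieldType) (n : nat) (A : vectType K)
    (H : homAlgebra n A) : Prop :=
  forall x : {ffun 'I_n -> A},
    twist H (bracket H x) = bracket H [ffun j => twist H (x j)].

Definition nilpotent_end (K : fieldType) (A : vectType K) (f : 'End(A)) : Prop :=
  exists m : nat, forall x : A, iter m f x = 0.

(* Jordan form of a nilpotent endomorphism (all diagonal entries are 0), with
   the 1's on the superdiagonal: each basis vector is sent to 0 or to its
   predecessor, so the first one is sent to 0. *)
Definition nilpotent_jordan_basis (K : fieldType) (A : vectType K) (m : nat)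
    (f : 'End(A)) (e : m.-tuple A) : Prop :=
  basis_of {:A} e /\
  forall i : 'I_m,
    f (tnth e i) = 0 \/
    exists2 j : 'I_m, i = j.+1 :> nat & f (tnth e i) = tnth e j.

(* Main.v *)
(* If [dim ker alpha >= 2], at least two of the [n+1] basis vectors are killed
   by [alpha], so [n] distinct ones always include such a vector.  Hence
   [[alpha x_1, ..., alpha x_n]] vanishes identically and multiplicativity says
   that [alpha] kills all brackets.  As [alpha] sends the basis vectors outside
   its kernel to distinct basis vectors, this is a condition on the structure
   constants alone. *)
Require Import Defs.
From HB Require Import structures.
From mathcomp Require Import all_boot all_order all_fingroup all_algebra.
Set Implicit Arguments.
Unset Strict Implicit.
Unset Printing Implicit Defensive.
Import GRing.Theory.
Local Open Scope ring_scope.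

Lemma multilinear_eq0_basis (K : fieldType) (n m : nat) (A : vectType K)
    (B : lmodType K) (f : {ffun 'I_n -> A} -> B) (e : m.-tuple A) :
    multilinear f -> basis_of {:A} e ->
    (forall i : {ffun 'I_n -> 'I_m}, f [ffun j => tnth e (i j)] = 0) ->
  forall x, f x = 0.
Proof.
move=> fL eB f0 x.
have {f0} fb0 (y : {ffun 'I_n -> A}) :
    (forall j, exists l, y j = tnth e l) -> f y = 0.
  move=> /fin_all_exists[i yE].
  rewrite -(f0 (finfun i)); congr f; apply/ffunP => j.
  by rewrite !ffunE yE.
(* Induction on the number [k] of leading arguments that may be arbitrary. Argument [k] is expanded
   in the basis, and each resulting term has one arbitrary argument fewer. *)
suff P k (y : {ffun 'I_n -> A}) :
    (forall j : 'I_n, (k <= j)%N -> exists l, y j = tnth e l) -> f y = 0.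
  by apply: (P n) => j; rewrite leqNgt ltn_ord.
elim: k y => [|k IHk] y yP; first by apply: fb0 => j; apply: yP.
have [kn|nk] := ltnP k n; last first.
  by apply: IHk => j /(leq_trans nk); rewrite leqNgt ltn_ord.
pose k0 := Ordinal kn.
pose g0 u := f (subst_arg y k0 u).
pose gM := GRing.isLinear.Build K A B _ g0 (fL y k0).
pose g : {linear A -> B} := HB.pack g0 gM.
have -> : f y = g (y k0).
  congr f; apply/ffunP => j; rewrite ffunE.
  by case: eqP => [->|].
rewrite (coord_basis eB (memvf (y k0))) linear_sum big1 // => l _.
rewrite linearZ /=; suff -> : g0 e`_l = 0 by rewrite scaler0.
apply: IHk => j kj; rewrite ffunE; case: eqP => [_|/eqP jk0].
  by exists l; rewrite (tnth_nth 0).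
apply: yP; rewrite ltn_neqAle kj andbT.
by apply: contraNneq jk0 => kE; apply/eqP/val_inj.
Qed.

(** The transposition of [i] and [j] fixes [x] but negates [f x], so twice [f x] is zero. *)
Lemma skew_symmetric_eq0 (K : fieldType) (n : nat) (A B : lmodType K)
    (f : {ffun 'I_n -> A} -> B) (x : {ffun 'I_n -> A}) (i j : 'I_n) :
  2%:R != 0 :> K -> skew_symmetric f -> i != j -> x i = x j -> f x = 0.
Proof.
move=> K2 fS ij xij.
have := fS (tperm i j) x; rewrite odd_tperm ij expr1 scaleN1r.
have -> : [ffun l => x (tperm i j l)] = x.
  by apply/ffunP => l; rewrite ffunE; case: tpermP => [->|->|].
move/eqP; rewrite -subr_eq0 opprK -mulr2n -scaler_nat scaler_eq0.
by rewrite (negPf K2) => /eqP.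
Qed.

Lemma jordan_basis_ker (K : fieldType) (m : nat) (A : vectType K)
    (f : 'End(A)) (e : m.-tuple A) (a : 'I_m -> K) :
    nilpotent_jordan_basis f e ->
  f (\sum_(k < m) a k *: tnth e k) = 0 <->
  (forall k, tnth e k \notin lker f -> a k = 0).
Proof.
case=> /basis_free eF fe; split=> [fa0 k|a0]; last first.
  rewrite linear_sum big1 // => k _; rewrite linearZ /=.
  have [|/a0 ->] := boolP (tnth e k \in lker f); last by rewrite scale0r.
  by rewrite memv_ker => /eqP ->; rewrite scaler0.
rewrite memv_ker; case: (fe k) => [->|[j kj fk] _]; first by rewrite eqxx.
(* Since [f] sends [e_k] to [e_j], the coordinate at [j] isolates [a k]: any other [l] with
   [f e_l = e_j] would satisfy [l = j + 1 = k]. *)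
have := congr1 (coord e j) fa0.
rewrite !linear_sum linear0 (bigD1 k) //= [X in _ + X]big1 => [|l lk].
  by rewrite !linearZ /= fk (tnth_nth 0) coord_free // eqxx mulr1 addr0.
rewrite !linearZ /=; case: (fe l) => [->|[i li ->]].
  by rewrite linear0 mulr0.
rewrite (tnth_nth 0) coord_free //; case: eqP => [ij|]; last by rewrite mulr0.
by case/eqP: lk; apply: val_inj; rewrite /= li kj ij.
Qed.

(** By [jordan_basis_ker], a kernel vector has nonzero coordinates only along basis vectors in the
    kernel, so these span the kernel. *)
Lemma jordan_basis_dim_ker (K : fieldType) (m : nat) (A : vectType K)
    (f : 'End(A)) (e : m.-tuple A) :
    nilpotent_jordan_basis f e ->
  (\dim (lker f) <= #|[set k | tnth e k \in lker f]|)%N.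
Proof.
move=> eJ; set Z := [set k | _].
have kerS : (lker f <= <<[seq tnth e k | k in Z]>>)%VS.
  apply/subvP => x.
  have xE : x = \sum_k coord e k x *: tnth e k.
    rewrite {1}(coord_basis eJ.1 (memvf x)).
    by apply: eq_bigr => k _; rewrite (tnth_nth 0).
  rewrite memv_ker => /eqP; rewrite {1}xE => /(jordan_basis_ker _ eJ) x0; rewrite xE.
  apply: rpred_sum => k _.
  have [kZ|/x0 ->] := boolP (tnth e k \in lker f); last first.
    by rewrite scale0r mem0v.
  by apply/memvZ/memv_span/image_f; rewrite inE.
by rewrite (leq_trans (dimvS kerS)) // (leq_trans (dim_span _)) // size_image.
Qed.

Lemma bracket_twist_eq0 (K : fieldType) (n : nat) (A : vectType K)
    (H : homAlgebra n A) (e : n.+1.-tuple A) :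
    2%:R != 0 :> K -> skew_symmetric (bracket H) ->
    nilpotent_jordan_basis (twist H) e -> (2 <= \dim (lker (twist H)))%N ->
  forall x : {ffun 'I_n -> A}, bracket H [ffun j => twist H (x j)] = 0.
Proof.
move=> K2 HS eJ dimk.
have HL := @bracket_multilinear _ _ _ H.
have fL : multilinear (fun x : {ffun 'I_n -> A} =>
    bracket H [ffun j => twist H (x j)]).
  move=> x i a u v.
  have sE w : [ffun j => twist H (subst_arg x i w j)] =
      subst_arg [ffun j => twist H (x j)] i (twist H w).
    by apply/ffunP => j; rewrite !ffunE; case: eqP.
  by rewrite !sE linearP HL.
apply: (multilinear_eq0_basis fL eJ.1) => i.
have [/injectiveP i_inj|/injectivePn[j [l jl ijl]]] := boolP (injectiveb i);
  last by apply: (skew_symmetric_eq0 K2 HS jl); rewrite !ffunE ijl.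
have [j iZ] : exists j, tnth e (i j) \in lker (twist H).
  apply/existsP/contraT; rewrite negb_exists => /forallP iZ.
  (* Otherwise the indices of kernel basis vectors avoid the image of the injective [i]. Its
     complement has [n + 1 - n = 1] element, against the kernel dimension of at least 2. *)
  have /subset_leq_card : [set k | tnth e k \in lker (twist H)] \subset
      ~: [set i j | j : 'I_n].
    apply/subsetP => k; rewrite !inE => kZ.
    by apply/imsetP => -[j _ kE]; move: (iZ j); rewrite -kE kZ.
  rewrite [leqRHS]cardsCs setCK card_imset // !card_ord subSnn.
  by move/(leq_trans (jordan_basis_dim_ker eJ))/(leq_trans dimk).
set y := [ffun _ => _].
have yj : y = subst_arg y j 0.
  apply/ffunP => l; rewrite [RHS]ffunE; case: eqP => // ->.
  by rewrite !ffunE; apply/eqP; rewrite -memv_ker.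
(* Linearity in argument [j] at [-1 *: 0 + 0] says that the bracket of [y] equals minus itself plus
   itself, hence is zero. *)
by have := HL y j (-1) 0 0; rewrite scaler0 addr0 -yj scaleN1r addNr.
Qed.

Theorem corollary3 (K : fieldType) (n : nat) (A : vectType K)
    (H : homAlgebra n A) (e : n.+1.-tuple A)
    (c : {ffun 'I_n -> 'I_n.+1} -> 'I_n.+1 -> K)
    (charK : [pchar K] =i pred0)
    (n_ge2 : (2 <= n)%N)
    (dimA : \dim {:A} = n.+1)
    (skewH : skew_symmetric (bracket H))
    (nilH : nilpotent_end (twist H))
    (eJ : nilpotent_jordan_basis (twist H) e)
    (structure_constants : forall i : {ffun 'I_n -> 'I_n.+1},
        bracket H [ffun j => tnth e (i j)] =
          \sum_(k < n.+1) c i k *: tnth e k)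
    (dim_ker : (2 <= \dim (lker (twist H)))%N) :
  homAlgebra_multiplicative H <->
  (forall (i : {ffun 'I_n -> 'I_n.+1}) (k : 'I_n.+1),
      tnth e k \notin lker (twist H) -> c i k = 0).
Proof.
have K2 : 2%:R != 0 :> K by rewrite (iffLR (pcharf0P K) charK).
have rhs0 := bracket_twist_eq0 K2 skewH eJ dim_ker.
split=> [mulH i|c0 x].
  apply/(jordan_basis_ker _ eJ).
  by rewrite -structure_constants mulH rhs0.
rewrite rhs0.
(* It remains to show that [twist H] kills all brackets. By multilinearity, brackets of basis
   vectors suffice, and the structure constants describe those. *)
have fL : multilinear (fun x => twist H (bracket H x)).
  by move=> y j a u v; rewrite bracket_multilinear linearP.
apply: (multilinear_eq0_basis fL eJ.1) => i.
by rewrite structure_constants; apply/(jordan_basis_ker _ eJ)/c0.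
Qed.
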